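(* Let $I=[0,T]$ and let the process $X(t)=\int_I K(t,s)\,dW(s)$, $t\in I$, be non-anticipating, where $W$ is a standard Brownian motion. Let $\mathcal K^*$ be the operator corresponding to the kernel $K$. (a) If $s_0<s_1<\dots<s_N$ are points of $I$ and $f$ is the step function $f(s)=\sum_{k=0}^{N-1}a_k\big(\chi_{s_{k+1}}(s)-\chi_{s_k}(s)\big)$, then $$\mathcal K^*f(s)=\sum_{i=0}^{N-1}\big(\chi_{s_{i+1}}(s)-\chi_{s_i}(s)\big)\Big(a_iK(s_{i+1},s)+\sum_{k=i+1}^{N-1}a_k\big(K(s_{k+1},s)-K(s_k,s)\big)\Big).$$ (b) If the function $K(\cdot,s)$ has bounded variation for every $s$ and $\lim_{\delta\to0,\,\delta>0}K(s+\delta,s)=K(s^+,s)$ exists for all $s\in(0,T)$, then $$\mathcal K^*f(s)=K(s^+,s)f(s)+\int_s^T f(t)\,K(dt,s)$$ for every continuous function $f$ on $[0,T]$. (c) Suppose that the function $K(t,s)$ has the following properties: (1) $K$ is continuous and non-negative for $0\le s\le t\le T$, and $\sup_{0<t<T}K(t,t)\le K_0$; (2) $K^{(1)}(t,s)=\partial K(t,s)/\partial t$ is non-negative for $0<s<t<T$ and there exists a number $K_1=K_1(T)$ such that $$\sup_{0<t<T}\int_0^tK(T,s)\,K^{(1)}(t,s)\,ds\le K_1(T).$$ Then the corresponding operator $\mathcal K^*$ defined by the formula in (b) is bounded on $L_2((0,T))$ and its operator norm $\|\mathcal K^*\|$ satisfies $$\|\mathcal K^*\|^2\le\begin{cases}2(K_0^2+K_1),&\text{if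 }K_0>0;\\ K_1,&\text{if }K_0=0.\end{cases}$$
   Context: $\chi_t$ is the indicator function of $[0,t]$, so $\chi_{t_2}-\chi_{t_1}$ is the indicator of $(t_1,t_2]$ for $t_1<t_2$. The kernel $K:I\times I\to\mathbb R$ has $K(t,\cdot)\in L_2(I)$ for each $t$. The process $X$ is non-anticipating if it is adapted to the filtration generated by $W$; then $K(t,s)=0$ for $s>t$, i.e. $X(t)=\int_0^tK(t,s)\,dW(s)$. The operator $\mathcal K^*$ corresponding to $K$ is determined by $(\mathcal K^*\chi_t)(s)=K(t,s)$ and linearity: on a step function $f=\sum_{k=0}^{N-1}a_k(\chi_{s_{k+1}}-\chi_{s_k})$, $$\mathcal K^*f(s)=\sum_{k=0}^{N-1}a_k\big(K(s_{k+1},s)-K(s_k,s)\big).$$ For a continuous $f$ on $[0,T]$, $\mathcal K^*f(s)$ is obtained by passing to the limit: it is the limit, for each fixed $s$, of $\mathcal K^*f_n(s)$, where $f_n=\sum_k f(s_k)(\chi_{s_{k+1}}-\chi_{s_k})$ are the step functions corresponding to partitions $0=s_0<\dots<s_N=T$ with $\max_j|s_{j+1}-s_j|\to0$. The integral $\int_s^Tf(t)K(dt,s)$ is the Stieltjes integral with respect to $t\mapsto K(t,s)$ not including any jump at $t=s$, that is, $\lim_{\varepsilon\downarrow0}\int_{s+\varepsilon}^Tf(t)K(dt,s)$ (Riemann–Stieltjes). In (c), the formula in (b) reads $\mathcal K^*f(s)=K(s,s)f(s)+\int_s^TK^{(1)}(t,s)f(t)\,dt$, initially for smooth compactly supported functions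 on $(0,T)$, and ''bounded on $L_2((0,T))$'' means that it extends to a bounded operator on $L_2((0,T))$.
   Formalization: Part (a) is stated only for points s of I with s > s_0; for s ≤ s_0 the right-hand side is 0 while K*f(s) need not vanish (e.g. K(t,s)=max(t-s,0), N=1, a_0=1, s<s_0 gives s_1-s_0). *)

(* Defs.v *)
From HB Require Import structures.
From mathcomp Require Import all_boot all_order all_algebra.
From mathcomp Require Import all_classical all_reals all_analysis.

Set Implicit Arguments.
Unset Strict Implicit.
Unset Printing Implicit Defensive.

Import Order.TTheory GRing.Theory Num.Theory.
Import numFieldNormedType.Exports.

Local Open Scope classical_set_scope.
Local Open Scope ring_scope.

Section StepFunctions.
Context {R : realType}.
Implicit Types (T : R) (K : R -> R -> R) (f g : R -> R) (Kstar : (R -> R) -> R -> R).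

Definition chi (t : R) : R -> R := \1_`[0, t].

Definition stepfun (p a : nat -> R) (N : nat) : R -> R :=
  fun x => \sum_(k < N) a k * (chi (p k.+1) x - chi (p k) x).

Definition step_space T : set (R -> R) :=
  [set f | exists n (c t : nat -> R),
    (forall i, (i < n)%N -> t i \in `[0, T]) /\
    f = fun x => \sum_(i < n) c i * chi (t i) x].

(* The chi t, 0 <= t <= T, are linearly independent as functions, so the two
   clauses fix Kstar on step_space T; its other values are left unconstrained. *)
Definition corresponding_operator T K Kstar : Prop :=
  (forall t s : R, t \in `[0, T] -> s \in `[0, T] -> Kstar (chi t) s = K t s) /\
  (forall c f g s, step_space T f -> step_space T g -> s \in `[0, T] ->
    Kstar (fun x => c * f x + g x) s = c * Kstar f s + Kstar g s).

(* [nth b (a :: s)] enumerates the nodes of the partition [s] of [a, b], as in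
   the library's [variation]. *)
Definition mesh_lt (a b : R) (s : seq R) (delta : R) : Prop :=
  forall k, (k < size s)%N ->
    nth b (a :: s) k.+1 - nth b (a :: s) k < delta.

(* [l] is the value at [x] of the operator on the continuous function [f]: the
   limit of its values on left-endpoint step approximations of [f]. *)
Definition is_Kstar_limit T Kstar f (x l : R) : Prop :=
  forall e : R, 0 < e -> exists2 delta : R, 0 < delta &
    forall s : seq R, itv_partition 0 T s -> mesh_lt 0 T s delta ->
      `|Kstar (stepfun (nth T (0 :: s)) (f \o nth T (0 :: s)) (size s)) x - l|
        < e.

Definition is_RS_integral f g (a b l : R) : Prop :=
  forall e : R, 0 < e -> exists2 delta : R, 0 < delta &
    forall (s : seq R) (xi : nat -> R),
      itv_partition a b s -> mesh_lt a b s delta ->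
      (forall k, (k < size s)%N ->
        nth b (a :: s) k <= xi k <= nth b (a :: s) k.+1) ->
      `|\sum_(k < size s)
          f (xi k) * (g (nth b (a :: s) k.+1) - g (nth b (a :: s) k)) - l| < e.

Definition is_RS_integral_right f g (a b l : R) : Prop :=
  exists2 J : R -> R,
    (forall u : R, u \in `]a, b[ -> is_RS_integral f g u b (J u)) &
    J u @[u --> a^'+] --> l.

End StepFunctions.

Section L2.
Context {R : realType}.
Local Notation mu := (@lebesgue_measure R).
Implicit Types (D : set R) (f g : R -> R).

Definition L2norm D f : \bar R := 'N[mu]_(2%:E)[EFin \o (f \_ D)].

Definition L2 D f : Prop := f \_ D \in Lfun mu 2%:E.

(* Operators on the space of classes of square-integrable functions on D modulo
   a.e. equality, presented on representatives. *)
Definition L2_operator D (A : (R -> R) -> R -> R) : Prop :=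
  [/\ forall f, L2 D f -> L2 D (A f),
      forall f g, L2 D f -> L2 D g -> ae_eq mu D f g -> ae_eq mu D (A f) (A g) &
      forall c f g, L2 D f -> L2 D g ->
        ae_eq mu D (A (fun x => c * f x + g x)) (fun x => c * A f x + A g x)].

Definition L2_opnorm D (A : (R -> R) -> R -> R) : \bar R :=
  ereal_sup [set L2norm D (A f) | f in [set f | L2 D f /\ (L2norm D f <= 1)%E]].

Definition test_function (T : R) (phi : R -> R) : Prop :=
  (forall n (x : R), derivable (derive1n n phi) x 1) /\
  (exists a b : R, [/\ 0 < a, b < T & forall x : R, x \notin `[a, b] -> phi x = 0]).

End L2.

Section Brownian.
Context {R : realType} {d : measure_display} {Omega : measurableType d}
  {P : probability Omega R}.
Implicit Types (W X : R -> {RV P >-> R}) (T : R).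

Definition brownian_motion W : Prop :=
  [/\ {ae P, forall w, W 0 w = 0},
      forall (n : nat) (t : nat -> R) (B : nat -> set R), 0 <= t 0%N ->
        (forall i, (i < n)%N -> t i <= t i.+1) ->
        (forall i, measurable (B i)) ->
        P (\bigcap_(i in `I_n) [set w | B i (W (t i.+1) w - W (t i) w)]) =
        (\prod_(i < n) P [set w | B i (W (t i.+1) w - W (t i) w)%R])%E,
      forall (s t : R) (B : set R), 0 <= s -> s < t -> measurable B ->
        P [set w | B (W t w - W s w)] = normal_prob 0 (Num.sqrt (t - s)) B &
      {ae P, forall w, {within `[0, +oo[, continuous (fun t : R => W t w)}}].

Definition wiener_sum W (p a : nat -> R) (N : nat) : Omega -> R :=
  fun w => \sum_(k < N) a k * (W (p k.+1) w - W (p k) w).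

(* Y = \int_[0, T] h dW almost surely *)
Definition is_wiener_integral W T (h : R -> R) (Y : {RV P >-> R}) : Prop :=
  exists (N : nat -> nat) (p a : nat -> nat -> R),
  [/\ forall n k, (k <= N n)%N -> p n k \in `[0, T],
      forall n k, (k < N n)%N -> p n k < p n k.+1,
      L2norm `[0, T] (stepfun (p n) (a n) (N n) \- h) @[n --> \oo] --> 0%E &
      ('N[P]_(2%:E)[EFin \o (wiener_sum W (p n) (a n) (N n) \- Y)%R])%E
        @[n --> \oo] --> 0%E].

Definition natural_filtration W (t : R) : set (set Omega) :=
  <<s \bigcup_(u in `[0, t]) preimage_set_system setT (W u) measurable >>.

(* Wiener integrals are defined up to P-null sets, hence so is adaptedness. *)
Definition non_anticipating W T X : Prop :=
  forall t : R, t \in `[0, T] ->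
    exists2 Y : Omega -> R,
      (forall B : set R, measurable B -> natural_filtration W t (Y @^-1` B)) &
      {ae P, forall w, X t w = Y w}.

End Brownian.

Section Kernel.
Context {R : realType}.
Local Notation mu := (@lebesgue_measure R).
Implicit Types (K : R -> R -> R).

Definition dK K (t s : R) : R := derive1 (K ^~ s) t.

Definition triangle (T : R) : set (R * R) :=
  [set x | 0 <= x.2 /\ x.2 <= x.1 /\ x.1 <= T].

(* K(s+, s) f(s) + \int_s^T f(t) K(dt, s) when K(., s) is continuous on [s, T]
   with derivative dK K t s at t *)
Definition Kstar_formula (T : R) K (f : R -> R) (s : R) : R :=
  K s s * f s + \int[mu]_(t in `]s, T[) (dK K t s * f t).

End Kernel.

(* Main.v *)
Require Import Defs.
From HB Require Import structures.
From mathcomp Require Import all_boot all_order all_algebra.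
From mathcomp Require Import all_classical all_reals all_analysis.
From mathcomp Require Import measurable_realfun.
From mathcomp Require Import ring lra.

Set Implicit Arguments.
Unset Strict Implicit.
Unset Printing Implicit Defensive.

Import Order.TTheory GRing.Theory Num.Theory.
Import numFieldNormedType.Exports.

Local Open Scope classical_set_scope.
Local Open Scope ring_scope.

(** The operator is forced on step functions by linearity, and the formula in
    the first part is Abel summation there: every node before $s$ contributes
    $K(p_k,s)=0$ [stepfun_abel_sum].

    For continuous $f$ the value at $s$ is a Riemann--Stieltjes integral
    $\int_0^T f\,dg$ with $g=K(\cdot,s)$ of bounded variation, approximated by
    left-endpoint sums.  Everything about it is read off one primitive $I$ with
    $|I(y)-I(x)-c\,(g(y)-g(x))|\le w\,(v(y)-v(x))$ whenever $|f-c|\le w$ on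
    $[x,y]$, where $v$ is the total variation of $g$.  Such an $I$ is built, for
    nondecreasing $g$, in the manner of Perron as an infimum of dominating
    functions [nondecreasing_stieltjes_primitive], and for general $g$ by Jordan
    decomposition.  Uniform continuity of $f$ then makes all sums over fine
    partitions of $[u,T]$ converge to $I(T)-I(u)$ [is_RS_integral_primitive].
    Since $g$ vanishes before $s$, the increment $I(u)-I(0)$ only sees the jump
    at $s$ and tends to $K(s^+,s)f(s)$ as $u\downarrow s$
    [stieltjes_primitive_right_limit]; this is the local term of the formula.

    For the bound on $L_2$, let $k(t,s)$ be $\partial K/\partial t$ on
    $0<s<t<T$ and $0$ elsewhere.  Since $K(\cdot,s)$ is nonnegative and
    nondecreasing, $\int k(t,s)\,dt\le K(T,s)$: this is Fatou's lemma for
    difference quotients [integral_derive1_le].  By the Cauchy--Schwarz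
    inequality for the measure $k(t,s)\,dt$,
    $$\Big(\int k(t,s)|f(t)|\,dt\Big)^2\le K(T,s)\int k(t,s)f(t)^2\,dt,$$
    and integrating in $s$, Tonelli's theorem and the assumption
    $\int K(T,s)k(t,s)\,ds\le K_1$ give at most $K_1\|f\|^2$ [schur_test].  The
    term $K(s,s)f(s)$ costs $K_0^2\|f\|^2$ and the inequality
    $(a+b)^2\le2a^2+2b^2$ the factor $2$; when $K_0=0$ that term is absent.  The
    same estimate shows that the integral converges absolutely for almost every
    $s$, so the formula itself defines the bounded operator on all of $L_2$. *)

(** * Step functions *)

Section step_functions.
Context {R : realType}.
Implicit Types (T s t c : R) (f : R -> R) (p a : nat -> R).

Lemma chiE t s : chi t s = ((0 <= s) && (s <= t))%:R.
Proof.
rewrite /chi indicE; congr ((nat_of_bool _)%:R).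
by apply/idP/idP; rewrite inE/= in_itv.
Qed.

Lemma step_space0 T : step_space T (fun=> 0).
Proof.
exists 0%N, (fun=> 0), (fun=> 0); split=> //.
by apply/funext => x; rewrite big_ord0.
Qed.

Lemma step_space_chiD T c t f : t \in `[0, T] -> step_space T f ->
  step_space T (fun x => c * chi t x + f x).
Proof.
move=> tT [n [b [u [uT ->]]]].
exists n.+1, (fun i => if i == n then c else b i), (fun i => if i == n then t else u i).
split=> [i|].
  by rewrite ltnS leq_eqVlt; case: eqP => //= _; exact: uT.
apply/funext => x; rewrite big_ord_recr/= eqxx addrC; congr (_ + _).
by apply: eq_bigr => i _; rewrite ltn_eqF.
Qed.

Lemma stepfun_recr p a N : stepfun p a N.+1 =
  fun x => a N * chi (p N.+1) x + ((- a N) * chi (p N) x + stepfun p a N x).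
Proof. by apply/funext => x; rewrite /stepfun big_ord_recr/=; ring. Qed.

Lemma step_space_stepfun T p a N : (forall k, (k <= N)%N -> p k \in `[0, T]) ->
  step_space T (stepfun p a N).
Proof.
elim: N => [|N IHN] pT.
  by rewrite (_ : stepfun _ _ _ = fun=> 0); [exact: step_space0|
     apply/funext => x; rewrite /stepfun big_ord0].
rewrite stepfun_recr; apply: step_space_chiD; first exact: pT.
apply: step_space_chiD; first exact/pT/leqnSn.
by apply: IHN => k kN; exact/pT/leqW.
Qed.

Section operator.
Context (T : R) (K : R -> R -> R) (Kstar : (R -> R) -> R -> R).
Hypothesis hK : corresponding_operator T K Kstar.

Lemma corresponding_operator_chiD c t f s : t \in `[0, T] -> s \in `[0, T] ->
  step_space T f ->
  Kstar (fun x => c * chi t x + f x) s = c * K t s + Kstar f s.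
Proof.
case: hK => Kchi Klin tT sT Tf; rewrite Klin// ?Kchi//.
rewrite (_ : chi t = fun x => 1 * chi t x + 0); last first.
  by apply/funext => x; rewrite mul1r addr0.
exact/step_space_chiD/step_space0.
Qed.

Lemma corresponding_operator_stepfun p a N s :
  (forall k, (k <= N)%N -> p k \in `[0, T]) -> s \in `[0, T] ->
  Kstar (stepfun p a N) s = \sum_(k < N) a k * (K (p k.+1) s - K (p k) s).
Proof.
move=> pT sT; elim: N pT => [|N IHN] pT.
  have := hK.2 1 _ _ s (step_space0 T) (step_space0 T) sT.
  rewrite (_ : (fun _ => _) = fun=> 0); last by apply/funext => x; rewrite mulr0 addr0.
  rewrite (_ : stepfun _ _ _ = fun=> 0); last by apply/funext => x; rewrite /stepfun big_ord0.
  by rewrite big_ord0; lra.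
have pT' k : (k <= N)%N -> p k \in `[0, T] by move=> kN; exact/pT/leqW.
have stT := step_space_stepfun a pT'.
rewrite stepfun_recr !corresponding_operator_chiD ?pT ?leqnSn//; last first.
  exact/step_space_chiD/stT/pT'.
by rewrite IHN// big_ord_recr/=; ring.
Qed.

(** The formula is Abel summation, carried out by adding one node at a time:
    the coefficients of the old jumps sum to $\chi_{p_N}(s)$ because $p_0<s$, and since
    $K(t,s)$ vanishes for $t<s$ the new increment $K(p_{N+1},s)-K(p_N,s)$ only
    needs to be compared in the three positions of $s$ relative to $p_N$ and
    $p_{N+1}$. *)
Lemma stepfun_abel_sum p a N s :
  (forall t s : R, t \in `[0, T] -> s \in `[0, T] -> t < s -> K t s = 0) ->
  (forall k, (k <= N)%N -> p k \in `[0, T]) ->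
  (forall k, (k < N)%N -> p k < p k.+1) ->
  s \in `[0, T] -> p 0%N < s ->
  \sum_(k < N) a k * (K (p k.+1) s - K (p k) s) =
  \sum_(i < N) (chi (p i.+1) s - chi (p i) s) *
    (a i * K (p i.+1) s +
     \sum_(i.+1 <= k < N) a k * (K (p k.+1) s - K (p k) s)).
Proof.
move=> K0 + + sT p0s; elim: N => [|N IHN] pT pinc; first by rewrite !big_ord0.
have sum_chi : \sum_(i < N) (chi (p i.+1) s - chi (p i) s) = chi (p N) s.
  rewrite -(big_mkord xpredT (fun i => chi (p i.+1) s - chi (p i) s)).
  rewrite telescope_sumr// [chi (p 0%N) s]chiE.
  by rewrite (leNgt s) p0s andbF subr0.
rewrite !big_ord_recr/= IHN; last 2 first.
  by move=> k kN; exact/pT/leqW.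
  by move=> k kN; exact/pinc/leqW.
rewrite big_geq// addr0.
under [X in _ = X + _]eq_bigr => i _ do
  rewrite (big_nat_recr N)//= addrA mulrDr.
rewrite big_split/= -mulr_suml sum_chi -addrA; congr (_ + _).
have s0 : 0 <= s by rewrite (itvP sT).
have pN := pinc N (ltnSn N).
rewrite !chiE s0/=.
have [sN|Ns] := leP s (p N); first by rewrite (le_trans sN (ltW pN)) subrr mul0r mul1r addr0.
rewrite [K (p N) s]K0 ?pT//.
by have [sN1|N1s] := leP s (p N.+1); [|rewrite [K (p N.+1) s]K0 ?pT//];
  rewrite ?subr0 ?subrr !(mul0r, mulr0, mul1r, add0r).
Qed.

End operator.
End step_functions.

(** * Primitives for Riemann--Stieltjes integrals *)

Section stieltjes_primitive.
Context {R : realType}.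
Implicit Types (f g H I v : R -> R) (a b x y c w m M : R).

Definition bounded_on f a b m M := forall x, a <= x -> x <= b -> m <= f x <= M.

(** Quantifying over the lower bounds $c$ of $f$ on $[x,y]$, instead of using
    their supremum, lets a bound on an interval restrict to its subintervals. *)
Definition dominates f g a b H := forall x y c, a <= x -> x <= y -> y <= b ->
  (forall t, x <= t -> t <= y -> c <= f t) -> c * (g y - g x) <= H y - H x.

Definition glue H1 x H2 : R -> R :=
  fun t => if t <= x then H1 t else H1 x + (H2 t - H2 x).

Lemma dominates_glue f g a b x H1 H2 : a <= x -> x <= b ->
  dominates f g a x H1 -> dominates f g x b H2 ->
  dominates f g a b (glue H1 x H2).
Proof.
move=> ax xb d1 d2 p q c ap pq qb cf; rewrite /glue.
have [qx|xq] := leP q x; first by rewrite (le_trans pq qx); exact: d1.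
have [px|xp] := leP p x.
  have := d1 p x c ap px (lexx _) (fun t pt tx => cf t pt (le_trans tx (ltW xq))).
  have := d2 x q c (lexx _) (ltW xq) qb (fun t xt => cf t (le_trans px xt)).
  by lra.
by have := d2 p q c (ltW xp) pq qb cf; lra.
Qed.

Lemma dominates_sub f g a b x y H : a <= x -> y <= b ->
  dominates f g a b H -> dominates f g x y H.
Proof.
by move=> ax yb d p q c xp pq qy; apply: d; rewrite ?(le_trans ax)// (le_trans qy).
Qed.

Lemma dominates_scale f g a b M :
  {in `[a, b] &, nondecreasing_fun g} ->
  (forall x, a <= x -> x <= b -> f x <= M) ->
  dominates f g a b (fun t => M * g t).
Proof.
move=> ndg fM x y c ax xy yb cf.
have ax' := le_trans ax xy; have xb := le_trans xy yb.
rewrite -mulrBr ler_wpM2r//.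
  by rewrite subr_ge0 ndg// in_itv/= ?ax ?ax'.
by rewrite (le_trans (cf x _ _))// fM.
Qed.

(** The primitive is the pointwise infimum, normalized at $a$, of all
    functions whose increments dominate every lower bound of $f$ times the
    increment of $g$.  Gluing makes the infimum local: above $[x,y]$ a
    dominating function may be replaced by $c\,g$ as soon as $f\le c$ there,
    so the increments of the infimum are squeezed from both sides, and no
    common refinement of partitions is needed. *)
Lemma nondecreasing_stieltjes_primitive f g a b m M : a <= b ->
  bounded_on f a b m M -> {in `[a, b] &, nondecreasing_fun g} ->
  exists I, forall x y c, a <= x -> x <= y -> y <= b ->
    ((forall t, x <= t -> t <= y -> c <= f t) -> c * (g y - g x) <= I y - I x) /\
    ((forall t, x <= t -> t <= y -> f t <= c) -> I y - I x <= c * (g y - g x)).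
Proof.
move=> ab fmM ndg.
pose U := [set H | H a = 0 /\ dominates f g a b H].
pose V t := [set H t | H in U].
pose I t := inf (V t).
have V0 t : V t !=set0.
  exists (M * g t - M * g a), (fun t => M * g t - M * g a) => //; split.
    by rewrite subrr.
  move=> x y c ax xy yb cf.
  have := @dominates_scale f g a b M ndg _ x y c ax xy yb cf.
  rewrite opprB addrA subrK; apply.
  by move=> z az zb; have /andP[] := fmM z az zb.
have Vlb t : a <= t -> t <= b -> lbound (V t) (m * (g t - g a)).
  move=> at_ tb _ [H [Ha dH] <-].
  have := dH a t m (lexx _) at_ tb; rewrite Ha subr0; apply => z az zt.
  by have /andP[] := fmM z az (le_trans zt tb).
have Iinf t H : a <= t -> t <= b -> U H -> I t <= H t.
  move=> at_ tb UH; apply: ge_inf; last by exists H.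
  by exists (m * (g t - g a)); exact: Vlb.
have Ige t z : (forall H, U H -> z <= H t) -> z <= I t.
  by move=> zH; apply: lb_le_inf => // _ [H UH <-]; exact: zH.
exists I => x y c ax xy yb; have xb := le_trans xy yb; have ay := le_trans ax xy.
split=> [cf|fc].
  rewrite lerBrDr; apply: Ige => H UH; have := Iinf x H ax xb UH.
  by have := UH.2 x y c ax xy yb cf; lra.
rewrite lerBlDr -lerBlDl; apply: Ige => H [Ha dH].
have : U (glue (glue H x (fun t => c * g t)) y H).
  split; first by rewrite /glue ay ax.
  apply: dominates_glue => //; last exact: dominates_sub dH.
  apply: dominates_glue => //; first exact: dominates_sub dH.
  apply: dominates_scale => // p q; rewrite !in_itv/= => /andP[xp py] /andP[xq qy].
  by apply: ndg; rewrite in_itv/= ?(le_trans ax) ?(le_trans py) ?(le_trans qy).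
move=> /(Iinf y _ ay yb); rewrite /glue lexx.
case: ltgtP xy => // [xy _|-> _]; last by lra.
by lra.
Qed.

Lemma ball_bounds f c w x y :
  (forall t, x <= t -> t <= y -> `|f t - c| <= w) ->
  (forall t, x <= t -> t <= y -> c - w <= f t) /\
  (forall t, x <= t -> t <= y -> f t <= c + w).
Proof.
by move=> fcw; split=> t xt ty; have := fcw t xt ty; rewrite ler_distl => /andP[].
Qed.

(** Jordan decomposition of $g$ reduces to the nondecreasing case; the errors
    add up to the increment of the total variation because the positive and
    negative variations do. *)
Lemma bounded_variation_stieltjes_primitive f g a b m M : a <= b ->
  bounded_on f a b m M -> bounded_variation a b g ->
  exists I, forall x y c w, a <= x -> x <= y -> y <= b ->
    (forall t, x <= t -> t <= y -> `|f t - c| <= w) ->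
    `|I y - I x - c * (g y - g x)| <=
      w * (fine (total_variation a y g) - fine (total_variation a x g)).
Proof.
move=> ab fmM BVg.
pose P := fine \o pos_tv a g; pose N := fine \o neg_tv a g.
have BVNg : bounded_variation a b (\- g) by exact/bounded_variationN.
have [IP IPE] := nondecreasing_stieltjes_primitive ab fmM (fine_neg_tv_nondecreasing BVNg).
have [IN INE] := nondecreasing_stieltjes_primitive ab fmM (fine_neg_tv_nondecreasing BVg).
exists (fun t => IP t - IN t) => x y c w ax xy yb fcw.
have gE z : a <= z -> z <= b -> g z = P z - N z.
  by move=> az zb; rewrite (bounded_variation_pos_neg_tvE BVg)// in_itv/= az.
have vE z : a <= z -> z <= b -> fine (total_variation a z g) = P z + N z.
  move=> az zb.
  have fin : total_variation a z g \is a fin_num.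
    by apply/bounded_variationP => //; exact: bounded_variationl BVg.
  rewrite /P /N /= /pos_tv /neg_tv total_variationN.
  by rewrite -(fineK fin)/=; lra.
have ay := le_trans ax xy; have xb := le_trans xy yb.
rewrite !vE// !gE//.
have [lo hi] := ball_bounds fcw.
have [/(_ lo) + _] := IPE x y (c - w) ax xy yb.
have [_ /(_ hi) +] := IPE x y (c + w) ax xy yb.
have [/(_ lo) + _] := INE x y (c - w) ax xy yb.
have [_ /(_ hi) +] := INE x y (c + w) ax xy yb.
rewrite ler_norml -/P -/N /= => h1 h2 h3 h4.
by apply/andP; split; lra.
Qed.

End stieltjes_primitive.

(** * Riemann--Stieltjes sums over fine partitions *)

Section riemann_stieltjes.
Context {R : realType}.
Implicit Types (f g I v : R -> R) (a b x y c w e : R).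

Lemma segment_unif_continuous f a b : {within `[a, b], continuous f} ->
  forall e, 0 < e -> exists2 d : R, 0 < d & forall x y,
    x \in `[a, b] -> y \in `[a, b] -> `|x - y| < d -> `|f x - f y| < e.
Proof.
move=> /subspace_continuousP cf e e0.
pose P (d x : R) := x \in `[a, b] -> forall y, y \in `[a, b] ->
  `|x - y| < d -> `|f x - f y| < e.
have /compact_near_coveringP cov := @segment_compact R a b.
have [|d /= d0 dP] := cov R (0^'+) P _.
  move=> x xab; have e20 : 0 < e / 2 by rewrite divr_gt0.
  have /cvgrPdist_lt/(_ _ e20) := cf x xab.
  rewrite near_withinE => -[r /= r0 rP].
  have r20 : 0 < r / 2 by rewrite divr_gt0.
  exists (ball x (r / 2), [set d | d < r / 2]) => /=.
    by split; [exact: nbhsx_ballx|exact: nbhs_right_lt].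
  move=> [z d] /= [xz dr] zab y yab zyd.
  have fxz : `|f x - f z| < e / 2.
    by apply: rP => //=; rewrite (lt_trans xz)//; lra.
  have fxy : `|f x - f y| < e / 2.
    apply: rP => //=; rewrite -(subrK z x) -addrA.
    by rewrite (le_lt_trans (ler_normD _ _))//; move: xz; rewrite /ball/=; lra.
  rewrite -(subrK (f x) (f z)) -addrA.
  by rewrite (le_lt_trans (ler_normD _ _))// (distrC (f z)); lra.
have d20 : 0 < d / 2 by rewrite divr_gt0.
exists (d / 2) => // x y xab yab xyd.
apply: (dP (d / 2) _ _ x xab xab y yab xyd) => //=.
by rewrite sub0r normrN gtr0_norm//; lra.
Qed.

Lemma itv_partition_step a b s k : itv_partition a b s -> (k < size s)%N ->
  [/\ a <= nth b (a :: s) k, nth b (a :: s) k < nth b (a :: s) k.+1 &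
      nth b (a :: s) k.+1 <= b].
Proof.
move=> abs ks; split.
- by apply: itv_partition_nth_ge => //; exact: ltnW.
- by case: abs => /(pathP b)/(_ k ks).
- exact: itv_partition_nth_le.
Qed.

Lemma itv_partition_telescope h a b s : itv_partition a b s ->
  \sum_(k < size s) (h (nth b (a :: s) k.+1) - h (nth b (a :: s) k)) =
  h b - h a :> R.
Proof.
move=> abs; rewrite -(big_mkord xpredT (fun k =>
  h (nth b (a :: s) k.+1) - h (nth b (a :: s) k))).
by rewrite (telescope_sumr (fun k => h (nth b (a :: s) k)))//= (itv_partition_nth_size _ abs).
Qed.

(** An approximate primitive: on short intervals the increment of $I$ agrees
    with $f\,\Delta g$ up to $w\,\Delta v$.  Telescoping $I$ and $v$ along a
    partition turns this into convergence of the Riemann--Stieltjes sums. *)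
Lemma is_RS_integral_primitive f g v I a b :
  {in `[a, b] &, nondecreasing_fun v} ->
  {within `[a, b], continuous f} ->
  (forall x y c w, a <= x -> x <= y -> y <= b ->
    (forall t, x <= t -> t <= y -> `|f t - c| <= w) ->
    `|I y - I x - c * (g y - g x)| <= w * (v y - v x)) ->
  is_RS_integral f g a b (I b - I a).
Proof.
move=> ndv cf IP e e0.
have [ab|ba] := leP a b; last first.
  exists 1 => // s xi abs; have := itv_partition_le abs.
  by rewrite leNgt ba.
have vab : 0 <= v b - v a by rewrite subr_ge0 ndv ?in_itv/= ?lexx ?ab.
have e'0 : 0 < e / (v b - v a + 1) by rewrite divr_gt0//; lra.
have [d d0 dP] := segment_unif_continuous cf e'0.
exists d => // s xi abs mesh xiP.
rewrite -(itv_partition_telescope I abs) -sumrB.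
apply: (@le_lt_trans _ _ (\sum_(k < size s) (e / (v b - v a + 1)) *
    (v (nth b (a :: s) k.+1) - v (nth b (a :: s) k)))).
  apply: (le_trans (ler_norm_sum _ _ _)); apply: ler_sum => k _.
  have [ak kk kb] := itv_partition_step abs (ltn_ord k).
  have /andP[kxi xik] := xiP k (ltn_ord k).
  rewrite distrC; apply: IP => // [|t kt tk]; first exact: ltW.
  apply/ltW/dP; rewrite ?in_itv/=.
  - by rewrite (le_trans ak kt) (le_trans tk kb).
  - by rewrite (le_trans ak kxi) (le_trans xik kb).
  - have := mesh k (ltn_ord k); rewrite ltr_norml; lra.
rewrite -mulr_sumr (itv_partition_telescope v abs).
rewrite -mulrA gtr_pMr// mulrC ltr_pdivrMr; lra.
Qed.

End riemann_stieltjes.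

(** * The operator on continuous functions *)

Section continuous_functions.
Context {R : realType}.
Implicit Types (f g : R -> R) (a b s l : R).

Lemma segment_bounded_on f a b : a <= b -> {within `[a, b], continuous f} ->
  exists m M, bounded_on f a b m M.
Proof.
move=> ab cf; have [cM _ fM] := EVT_max ab cf; have [cm _ fm] := EVT_min ab cf.
exists (f cm), (f cM) => x ax xb.
by rewrite fm ?fM// in_itv/= ax.
Qed.

Lemma fine_total_variation_nondecreasing a b g : bounded_variation a b g ->
  {in `[a, b] &, nondecreasing_fun (fun x => fine (total_variation a x g))}.
Proof.
move=> BVg x y xab yab xy; have ax : a <= x by rewrite (itvP xab).
have ay : a <= y by rewrite (itvP yab).
apply: fine_le; last exact: total_variation_nondecreasing xab yab xy.
- by apply/bounded_variationP => //; apply: bounded_variationl BVg; rewrite ?(itvP xab).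
- by apply/bounded_variationP => //; apply: bounded_variationl BVg; rewrite ?(itvP yab).
Qed.

(** All the mass that $g$ has on $[a,s]$ and just to the right of $s$
    concentrates at $s$: the primitive is constant on $[a,z]$ for $z<s$, where
    both $g$ and its variation are constant, and across $s$ its increment is
    compared with $f(s)\,\Delta g$. *)
Lemma stieltjes_primitive_right_limit f g (I : R -> R) a b s l : a < s -> s < b ->
  {within `[a, b], continuous f} -> bounded_variation a b g ->
  (forall x, a <= x -> x < s -> g x = 0) ->
  (forall x y c w, a <= x -> x <= y -> y <= b ->
    (forall t, x <= t -> t <= y -> `|f t - c| <= w) ->
    `|I y - I x - c * (g y - g x)| <=
      w * (fine (total_variation a y g) - fine (total_variation a x g))) ->
  g u @[u --> s^'+] --> l ->
  I u @[u --> s^'+] --> I a + l * f s.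
Proof.
move=> as_ sb cf BVg g0 IP gl; have ab := ltW (lt_trans as_ sb).
set v := fun x => fine (total_variation a x g).
have ndv := fine_total_variation_nondecreasing BVg.
have v0 x : a <= x -> x < s -> v x = 0.
  move=> ax xs; rewrite /v nondecreasing_total_variation//.
    by rewrite !g0// subrr.
  move=> p q; rewrite !in_itv/= => /andP[ap px] /andP[aq qx] _.
  by rewrite !g0// (le_lt_trans _ xs).
have I0 x : a <= x -> x < s -> I x = I a.
  move=> ax xs; have xb := ltW (lt_trans xs sb).
  have [m [M fmM]] := segment_bounded_on ab cf.
  have := IP a x 0 (`|m| + `|M|) (lexx _) ax xb; rewrite -/(v x) -/(v a).
  rewrite !v0// mul0r !subr0 mulr0 normr_le0 subr_eq0 => xa; apply/eqP/xa => t a_t tx.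
  have /andP[mf fM] := fmM t a_t (le_trans tx xb).
  rewrite ler_norml; have := ler_norm M; have := ler_norm (- m).
  by rewrite normrN; have := normr_ge0 m; have := normr_ge0 M; lra.
have vb : 0 <= v b by rewrite /v fine_ge0// total_variation_ge0.
suff Ig : (I u - g u * f s) @[u --> s^'+] --> I a.
  have IE : I = (fun u => I u - g u * f s + g u * f s).
    by apply/funext => u; rewrite subrK.
  by rewrite {1}IE; apply: (cvgD Ig); apply: cvgM gl _; exact: cvg_cst.
apply/cvgrPdist_le => e e0.
have e'0 : 0 < e / (v b + 1) by rewrite divr_gt0//; lra.
have [d d0 dP] := segment_unif_continuous cf e'0.
near=> u.
have su : s < u by near: u; exact: nbhs_right_gt.
have ub : u < b by near: u; exact: nbhs_right_lt.
have usd : u < s + d by near: u; apply: nbhs_right_lt; rewrite ltrDl.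
pose z := Num.max a (s - d / 2).
have az : a <= z by rewrite /z le_max lexx.
have dz : s - d / 2 <= z by rewrite /z le_max lexx orbT.
have zs : z < s by rewrite /z gt_max as_/=; lra.
have au := le_trans az (ltW (lt_trans zs su)).
have := IP z u (f s) (e / (v b + 1)) az (ltW (lt_trans zs su)) (ltW ub).
rewrite -/(v u) -/(v z) (I0 z)// (g0 z)// (v0 z)// !subr0 => bound.
rewrite distrC (_ : _ - I a = I u - I a - f s * g u); last by ring.
have vub : v u <= v b by rewrite ndv// ?in_itv/= ?lexx ?ab ?au ?ltW.
apply: (@le_trans _ _ (e / (v b + 1) * v u)).
  apply: bound => t zt tu; apply/ltW/dP; rewrite ?in_itv/=.
  - by rewrite (le_trans az zt) (le_trans tu (ltW ub)).
  - by rewrite !ltW.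
  - by rewrite ltr_norml; lra.
apply: (@le_trans _ _ (e / (v b + 1) * (v b + 1))).
  by rewrite ler_pM2l//; lra.
by rewrite divfK//; lra.
Unshelve. all: by end_near. Qed.

Lemma RS_integral_Kstar_limit T K Kstar f s l : corresponding_operator T K Kstar ->
  s \in `[0, T] -> is_RS_integral f (K ^~ s) 0 T l -> is_Kstar_limit T Kstar f s l.
Proof.
move=> hK sT fl e e0; have [d d0 dP] := fl e e0.
exists d => // p pT mesh.
rewrite (corresponding_operator_stepfun hK)//; last first.
  move=> k kp; rewrite in_itv/=.
  by rewrite (itv_partition_nth_ge _ pT) ?ltnS// (itv_partition_nth_le _ pT) ?ltnS.
apply: (dP p (nth T (0 :: p)) pT mesh) => k kp.
by have [_ /ltW kk _] := itv_partition_step pT kp; rewrite lexx.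
Qed.

(** Both sides come from one primitive $I$ of $f\,dK(\cdot,s)$: the operator
    converges to $I(T)-I(0)$, the integral over $[u,T]$ is $I(T)-I(u)$, and
    the term $K(s^+,s)f(s)$ is the limit of $I(u)-I(0)$ as $u\downarrow s$. *)
Lemma corresponding_operator_continuous T K Kstar f s :
  corresponding_operator T K Kstar ->
  (forall t, t \in `[0, T] -> t < s -> K t s = 0) ->
  bounded_variation 0 T (K ^~ s) -> cvg (K ^~ s @ s^'+) ->
  {within `[0, T], continuous f} -> s \in `]0, T[ ->
  exists2 J : R, is_RS_integral_right f (K ^~ s) s T J &
    is_Kstar_limit T Kstar f s (lim (K ^~ s @ s^'+) * f s + J).
Proof.
move=> hK K0 BVK cvK cf; rewrite in_itv/= => /andP[s0 sT].
have T0 := ltW (lt_trans s0 sT).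
have [m [M fmM]] := segment_bounded_on T0 cf.
have [I IP] := bounded_variation_stieltjes_primitive T0 fmM BVK.
have ndv := fine_total_variation_nondecreasing BVK.
exists (I T - I 0 - lim (K ^~ s @ s^'+) * f s); last first.
  rewrite addrC subrK; apply: (RS_integral_Kstar_limit hK).
    by rewrite in_itv/= !ltW.
  exact: is_RS_integral_primitive ndv cf IP.
exists (fun u => I T - I u).
  move=> u; rewrite in_itv/= => /andP[su uT].
  have u0 := ltW (lt_trans s0 su).
  have uT_sub x : x \in `[u, T] -> x \in `[0, T].
    by rewrite !in_itv/= => /andP[ux ->]; rewrite (le_trans u0 ux).
  apply: is_RS_integral_primitive.
  - by move=> x y xu yu; apply: ndv; exact: uT_sub.
  - by apply: continuous_subspaceW cf => x /= /uT_sub.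
  - by move=> x y c w ux; apply: IP; exact: le_trans u0 ux.
rewrite -addrA -opprD; apply: cvgB; first exact: cvg_cst.
apply: (stieltjes_primitive_right_limit s0 sT cf BVK _ IP cvK) => x x0 xs.
by rewrite K0// in_itv/= x0 ltW// (lt_trans xs sT).
Qed.

End continuous_functions.

(** * Measurability in the plane *)

Section plane_measurability.
Context {R : realType}.
Implicit Types (D : set (R * R)) (f : R * R -> R).

(** Open sets of the plane are countable unions of rational rectangles, hence
    belong to the product $\sigma$-algebra. *)
Lemma open_measurable_prod D : open D -> measurable D.
Proof.
move=> oD.
pose box (q : (rat * rat) * (rat * rat)) : set (R * R) :=
  `]ratr q.1.1, ratr q.1.2[%classic `*` `]ratr q.2.1, ratr q.2.2[%classic.
rewrite (_ : D = \bigcup_(q in [set q | box q `<=` D]) box q); last first.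
  apply/seteqP; split=> [[x y] Dxy|xy [q /= qD]]; last exact: qD.
  have [e /= e0 eD] : exists2 e : R, 0 < e & ball (x, y) e `<=` D.
    by have /nbhs_ballP[e e0 eD] := open_nbhs_nbhs (conj oD Dxy); exists e.
  have xe : x - e < x by rewrite ltrBlDr ltrDl.
  have xe' : x < x + e by rewrite ltrDl.
  have ye : y - e < y by rewrite ltrBlDr ltrDl.
  have ye' : y < y + e by rewrite ltrDl.
  have [p1 p1P] := rat_in_itvoo xe; have [p2 p2P] := rat_in_itvoo xe'.
  have [q1 q1P] := rat_in_itvoo ye; have [q2 q2P] := rat_in_itvoo ye'.
  exists ((p1, p2), (q1, q2)) => /=; last first.
    by rewrite /box/= !in_itv/= (itvP p1P) (itvP p2P) (itvP q1P) (itvP q2P).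
  move=> [z w] [] /=; rewrite !in_itv/= => /andP[p1z zp2] /andP[q1w wq2].
  move: p1P p2P q1P q2P; rewrite !in_itv/= => /andP[? ?] /andP[? ?] /andP[? ?] /andP[? ?].
  by apply: eD; split; rewrite /ball/= ltr_norml; apply/andP; split; lra.
rewrite bigcup_mkcond; apply: countable_bigcupT_measurable => // q.
by case: ifPn => // _; apply: measurableX; exact: measurable_itv.
Qed.

Lemma continuous_measurable_fun_prod D f : measurable D ->
  {within D, continuous f} -> measurable_fun D f.
Proof.
move=> mD /continuousP cf; apply: (measurability _ (RGenOpens.measurableE R)).
move=> _ [_ [a [b ->] <-]].
have /cf/open_subspaceP[V oV VD] : open `]a, b[%classic by exact: interval_open.
by rewrite setIC -VD; apply: measurableI => //; exact: open_measurable_prod.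
Qed.

End plane_measurability.

(** * The integral of a nonnegative derivative *)

Section integral_of_derivative.
Context {R : realType}.
Local Notation mu := (@lebesgue_measure R).
Implicit Types (g G P : R -> R) (a b x y : R).

Lemma derive1_harmonic_cvg g x : derivable g x 1 ->
  n.+1%:R * (g (x + n.+1%:R^-1) - g x) @[n --> \oo] --> derive1 g x.
Proof.
move=> dg; rewrite derive1E.
have /cvg_dnbhs_at_right/cvg_at_rightP/(_ (@harmonic R)) :
    h^-1 *: (g (h *: 1 + x) - g x) @[h --> 0^'] --> 'D_1 g x by exact: dg.
have h0 : (forall n, 0 < @harmonic R n) /\ @harmonic R n @[n --> \oo] --> 0.
  by split; [move=> n; rewrite invr_gt0|exact: cvg_harmonic].
move=> /(_ h0); apply: cvg_trans; apply: near_eq_cvg; apply: nearW => n /=.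
by rewrite /harmonic /= invrK [_%:A]mulr1 [_ + x]addrC.
Qed.

Lemma continuous_shift G h : continuous G -> continuous (fun x => G (x + h)).
Proof.
move=> cG x; apply: (cvg_comp (fun x => x + h) G _ (cG (x + h))).
by apply: cvgD; [exact: cvg_id|exact: cvg_cst].
Qed.

Lemma continuous_primitive G a b : a < b -> continuous G ->
  exists P : R -> R, forall x, a < x -> x < b -> is_derive x 1 P (G x).
Proof.
move=> ab cG.
pose P x := \int[mu]_(t in `[a, x]) G t.
exists P => x ax xb.
have iG : mu.-integrable `[a, b] (EFin \o G).
  apply: continuous_compact_integrable; first exact: segment_compact.
  exact: continuous_subspaceT.
have [dP PG] : derivable P x 1 /\ derive1 P x = G x.
  exact: continuous_FTC1_closed xb iG ax (cG x).
by split; [exact: dP|rewrite -PG derive1E].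
Qed.

(** The primitive $P$ of $G$ makes the translation explicit:
    $x\mapsto P(x+h)-P(x)$ is a primitive of $G(x+h)-G(x)$, and by the mean
    value theorem its values at $b$ and $a$ are $h\,G(\xi)$ with $\xi$ just to
    the right of $b$ and $a$. *)
Lemma integral_increment_le G a b h : a < b -> 0 < h -> continuous G ->
  {homo G : x y / x <= y} -> (forall x, b <= x -> G x = G b) ->
  (\int[mu]_(x in `[a, b]) (h^-1 * (G (x + h) - G x))%:E <= (G b - G a)%:E)%E.
Proof.
move=> ab h0 cG ndG Gb.
have [P dP] : exists P : R -> R, forall x, a - 1 < x -> x < b + h + 1 ->
    is_derive x 1 P (G x).
  by apply: continuous_primitive => //; lra.
pose F x := h^-1 * (P (x + h) - P x).
have dF x : a <= x -> x <= b -> is_derive x 1 F (h^-1 * (G (x + h) - G x)).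
  move=> ax xb.
  have d1 : is_derive x 1 P (G x) by apply: dP; lra.
  have d2 : is_derive (x + h) 1 P (G (x + h)) by apply: dP; lra.
  have d3 := @is_derive1_comp _ P (shift h) x _ _ d2 (is_derive_shift _ _ _).
  rewrite mulr1 in d3.
  exact: (@is_deriveZ _ _ _ (P \o shift h - P) h^-1 x 1 _ (is_deriveB d3 d1)).
have cF x : a <= x -> x <= b -> {for x, continuous F}.
  move=> ax xb; have [dFx _] := dF x ax xb.
  exact/differentiable_continuous/derivable1_diffP.
have mvt x : a <= x -> x <= b -> exists2 c, x <= c & F x = G c.
  move=> ax xb; have xh : x < x + h by rewrite ltrDl.
  have [z| |c xc Fc] := @MVT _ P G x (x + h) xh.
  - by rewrite in_itv/= => /andP[? ?]; apply: dP; lra.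
  - apply/continuous_in_subspaceT => z; rewrite inE/= in_itv/= => /andP[? ?].
    have [dPz _] : is_derive z 1 P (G z) by apply: dP; lra.
    exact/differentiable_continuous/derivable1_diffP.
  - exists c; first by rewrite (itvP xc).
    by rewrite /F Fc [x + h]addrC addrK mulrC mulfK ?gt_eqF.
rewrite (@continuous_FTC2 _ _ F)//.
- have [cb bc ->] := mvt b (ltW ab) (lexx _).
  have [ca ac ->] := mvt a (lexx _) (ltW ab).
  by rewrite -EFinB lee_fin Gb// lerB// ndG.
- apply: continuous_subspaceT => x; apply: cvgM; first exact: cvg_cst.
  apply: cvgB; last exact: cG.
  exact: continuous_shift.
- split=> [x|  |].
  + by rewrite in_itv/= => /andP[/ltW ax /ltW xb]; have [] := dF x ax xb.
  + by apply: cvg_at_right_filter; apply: cF => //; exact: ltW.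
  + by apply: cvg_at_left_filter; apply: cF => //; exact: ltW.
- move=> x; rewrite in_itv/= => /andP[/ltW ax /ltW xb].
  by rewrite derive1E; have [] := dF x ax xb.
Qed.

(** Composing with the retraction onto $[a,b]$ extends a function continuous on
    $[a,b]$ to the whole line. *)
Definition clamp a b x := Num.min (Num.max a x) b.

Lemma clamp_in a b x : a <= b -> clamp a b x \in `[a, b].
Proof.
by move=> ab; rewrite in_itv/= /clamp le_min le_max lexx ab/= ge_min lexx orbT.
Qed.

Lemma clamp_id a b x : a <= x -> x <= b -> clamp a b x = x.
Proof. by move=> ax xb; rewrite /clamp (max_idPr ax) (min_idPl xb). Qed.

Lemma clamp_le a b : {homo clamp a b : x y / x <= y}.
Proof.
move=> x y xy; rewrite /clamp le_min ge_min ge_min lexx orbT andbT.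
by rewrite (_ : Num.max a x <= Num.max a y)// ge_max !le_max lexx xy orbT.
Qed.

Lemma clamp_lip a b x y : `|clamp a b x - clamp a b y| <= `|x - y|.
Proof.
rewrite /clamp /Num.min /Num.max.
have := ler_norm (x - y); have := ler_norm (y - x); rewrite [`|y - x|]distrC.
by rewrite ler_norml => *; do !case: ifPn; rewrite -?leNgt => *; lra.
Qed.

Lemma continuous_clamp g a b : a <= b -> {within `[a, b], continuous g} ->
  continuous (g \o clamp a b).
Proof.
move=> ab cg x; apply/cvgrPdist_lt => e e0.
have [d d0 dP] := segment_unif_continuous cg e0.
near=> y; apply: dP; rewrite ?clamp_in//.
apply: le_lt_trans (clamp_lip a b x y) _.
by near: y; apply: cvgr_dist_lt.
Unshelve. all: by end_near. Qed.

(** Fatou's lemma for the difference quotients of $g$, extended by constants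
    outside $[a,b]$, yields this half of the fundamental theorem of calculus
    from differentiability alone, the derivative being possibly discontinuous
    and unbounded. *)
Lemma integral_derive1_le g a b : a < b -> {within `[a, b], continuous g} ->
  (forall x, x \in `]a, b[ -> derivable g x 1) ->
  (forall x, x \in `]a, b[ -> 0 <= derive1 g x) ->
  measurable_fun `]a, b[ (derive1 g) /\
  (\int[mu]_(x in `]a, b[) (derive1 g x)%:E <= (g b - g a)%:E)%E.
Proof.
move=> ab cg dg g'0.
pose G := g \o clamp a b.
have cG : continuous G by apply: continuous_clamp => //; exact: ltW.
have ndg := ger0_derive1_le_cc dg g'0 cg.
have ndG : {homo G : x y / x <= y}.
  by move=> x y xy; apply: ndg; rewrite ?clamp_in ?(ltW ab)//; exact: clamp_le.
have Ga : G a = g a by rewrite /G /= clamp_id// ltW.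
have Gb x : b <= x -> G x = g b.
  move=> bx; rewrite /G /= /clamp; congr g; apply/min_idPr.
  by rewrite le_max bx orbT.
pose D (n : nat) x := n.+1%:R * (G (x + n.+1%:R^-1) - G x).
have D0 n x : 0 <= D n x by rewrite mulr_ge0// subr_ge0 ndG// lerDl.
have cD n : continuous (D n).
  move=> x; apply: cvgM; first exact: cvg_cst.
  apply: cvgB; last exact: cG.
  exact: continuous_shift.
have Dg x : x \in `]a, b[ -> D n x @[n --> \oo] --> derive1 g x.
  move=> xab; apply: cvg_trans (derive1_harmonic_cvg (dg x xab)).
  move: xab; rewrite in_itv/= => /andP[ax xb]; have bx : 0 < b - x by rewrite subr_gt0.
  apply: near_eq_cvg; near=> n; rewrite /D /G /=.
  have nb : x + n.+1%:R^-1 < b.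
    rewrite -ltrBrDl; near: n.
    exact: (cvgr_lt _ (@cvg_harmonic R) _ bx).
  have an : a <= x + n.+1%:R^-1 by rewrite ltW// (lt_trans ax)// ltrDl.
  by rewrite !(@clamp_id a b)// ltW.
have mD n : measurable_fun setT (D n) by exact: continuous_measurable_fun.
have mg' : measurable_fun `]a, b[ (derive1 g).
  apply: (@measurable_fun_cvg _ _ _ _ D) => [n|x xab]; first exact: measurable_funTS.
  exact: Dg.
split=> //.
have -> : (\int[mu]_(x in `]a, b[) (derive1 g x)%:E =
           \int[mu]_(x in `]a, b[) limn_einf (fun n => (D n x)%:E))%E.
  apply: eq_integral => x; rewrite inE/= => xab; apply/esym.
  have Dgx : (D n x)%:E @[n --> \oo] --> (derive1 g x)%:E
    by apply: cvg_EFin; [exact: nearW|exact: Dg].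
  by have [] := cvg_limn_einf_sup Dgx.
apply: le_trans.
  apply: (@fatou _ _ _ mu `]a, b[ _ (fun n x => (D n x)%:E)) => // [n|n x _].
    apply/measurable_EFinP/measurable_funTS; exact: mD.
  by rewrite lee_fin.
rewrite limn_einf_lim; apply: lime_le; first exact: is_cvg_einfs.
apply: nearW => n; apply: (@le_trans _ _ (\int[mu]_(x in `]a, b[) (D n x)%:E)%E).
  by apply: ereal_inf_lbound; exists n => /=.
apply: (@le_trans _ _ (\int[mu]_(x in `[a, b]) (D n x)%:E)%E).
  apply: ge0_subset_integral => //.
  - apply/measurable_EFinP/measurable_funTS; exact: mD.
  - by move=> x _; rewrite lee_fin.
  - exact: subset_itv_oo_cc.
have := @integral_increment_le G a b n.+1%:R^-1 ab _ cG ndG _.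
rewrite invrK Ga (Gb b)//; apply; first by rewrite invr_gt0.
by move=> x bx; rewrite !Gb.
Unshelve. all: by end_near. Qed.

End integral_of_derivative.

(** * Schur's test with weights *)

Section schur_test.
Local Open Scope ereal_scope.

Lemma poweR2 {R : realType} (x : \bar R) : 0 <= x -> x `^ 2 = x ^+ 2.
Proof.
case: x => [x| |]//= x0; last by rewrite gt_eqF// expe2 mulyy.
by rewrite powR_mulrn// EFin_expe.
Qed.

Lemma Lnorm2_sqr d (X : measurableType d) (R : realType)
    (mu : {measure set X -> \bar R}) (f : X -> R) :
  'N[mu]_2%:E[EFin \o f] ^+ 2 = \int[mu]_x (f x ^+ 2)%:E.
Proof.
rewrite -poweR2 ?Lnorm_ge0// poweR_Lnorm//; apply: eq_integral => x _.
by rewrite /= powR_mulrn// real_normK ?num_real.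
Qed.

Section weighted.
Context d (X : measurableType d) (R : realType) (mu : {measure set X -> \bar R}).

Lemma weighted_cauchy_schwarz (h f : X -> R) :
  measurable_fun setT h -> measurable_fun setT f -> (forall x, (0 <= h x)%R) ->
  (\int[mu]_x (h x * `|f x|)%:E) ^+ 2 <=
  (\int[mu]_x (h x)%:E) * (\int[mu]_x (h x * f x ^+ 2)%:E).
Proof.
move=> mh mf h0.
pose r x := Num.sqrt (h x); pose g x := (r x * `|f x|)%R.
have mr : measurable_fun setT r.
  by apply: measurableT_comp mh; apply: continuous_measurable_fun; exact: sqrt_continuous.
have mg : measurable_fun setT g.
  by apply: measurable_funM => //; exact: measurableT_comp.
have rr x : (r x * r x = h x)%R by rewrite -expr2 sqr_sqrtr.
have -> : \int[mu]_x (h x * `|f x|)%:E = 'N[mu]_1[EFin \o (r \* g)%R].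
  rewrite Lnorm1; apply: eq_integral => x _ /=.
  have hf0 : (0 <= h x * `|f x|)%R by rewrite mulr_ge0.
  by rewrite /g mulrA rr (ger0_norm hf0).
have -> : \int[mu]_x (h x)%:E = 'N[mu]_2%:E[EFin \o r] ^+ 2.
  by rewrite Lnorm2_sqr; apply: eq_integral => x _; rewrite sqr_sqrtr.
have -> : \int[mu]_x (h x * f x ^+ 2)%:E =
    'N[mu]_2%:E[EFin \o g] ^+ 2.
  rewrite Lnorm2_sqr; apply: eq_integral => x _.
  by rewrite /g exprMn sqr_sqrtr// real_normK ?num_real.
rewrite !expe2 muleACA; apply: lee_pmul; rewrite ?Lnorm_ge0//;
by apply: hoelder => //; field.
Qed.

End weighted.

(** Schur's test with the Cauchy--Schwarz inequality taken against the measure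
    $k(t,s)\,dt$ itself: its total mass $w(s)$ is what the second hypothesis
    compensates after Tonelli's theorem. *)
Lemma schur_test d1 d2 (X : measurableType d1) (Y : measurableType d2)
    (R : realType) (m1 : {sigma_finite_measure set X -> \bar R})
    (m2 : {sigma_finite_measure set Y -> \bar R})
    (k : X * Y -> R) (w : Y -> R) (f : X -> R) (C : R) :
  measurable_fun setT k -> measurable_fun setT w -> measurable_fun setT f ->
  (forall z, (0 <= k z)%R) -> (forall s, (0 <= w s)%R) -> (0 <= C)%R ->
  (forall s, \int[m1]_t (k (t, s))%:E <= (w s)%:E) ->
  (forall t, \int[m2]_s (w s * k (t, s))%:E <= C%:E) ->
  \int[m2]_s (\int[m1]_t (k (t, s) * `|f t|)%:E) ^+ 2 <=
  C%:E * \int[m1]_t (f t ^+ 2)%:E.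
Proof.
move=> mk mw mf k0 w0 C0 kw wkC.
have mft : measurable_fun [set: X * Y] (fun z => f z.1).
  exact: measurableT_comp mf measurable_fst.
have mws : measurable_fun [set: X * Y] (fun z => w z.2).
  exact: measurableT_comp mw measurable_snd.
have mks s : measurable_fun setT (fun t => k (t, s)).
  exact: measurableT_comp mk (pair2_measurable s).
have mkt t : measurable_fun setT (fun s => k (t, s)).
  exact: measurableT_comp mk (pair1_measurable t).
have mf2 : measurable_fun setT (fun t => (f t ^+ 2)%R) by exact: measurable_funX.
pose F := fun z : X * Y => (k z * `|f z.1|)%:E.
have mF : measurable_fun setT F.
  by apply/measurable_EFinP; apply: measurable_funM => //; exact: measurableT_comp.
have F0 z : 0 <= F z by rewrite lee_fin mulr_ge0.
pose G := fun z : X * Y => (w z.2 * (k z * f z.1 ^+ 2))%:E.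
have mG : measurable_fun setT G.
  apply/measurable_EFinP; do 2 apply: measurable_funM => //.
  exact: measurable_funX.
have G0 z : 0 <= G z by rewrite lee_fin mulr_ge0// mulr_ge0// sqr_ge0.
have mFG := @measurable_fun_fubini_tonelli_G _ _ _ _ _ m1 F mF F0.
have mGG := @measurable_fun_fubini_tonelli_G _ _ _ _ _ m1 G mG G0.
apply: (@le_trans _ _ (\int[m2]_s \int[m1]_t G (t, s))).
  apply: ge0_le_integral => //.
  - by move=> s _; exact: sqre_ge0.
  - by under eq_fun do rewrite expe2; exact: emeasurable_funM.
  - move=> s _; apply: le_trans (weighted_cauchy_schwarz _ (mks s) mf _) _ => //.
    apply: (@le_trans _ _ ((w s)%:E * \int[m1]_t (k (t, s) * f t ^+ 2)%:E)).
      rewrite lee_wpmul2r//; apply: integral_ge0 => t _.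
      by rewrite lee_fin mulr_ge0// sqr_ge0.
    rewrite -ge0_integralZl_EFin// => [t _|].
      by rewrite lee_fin mulr_ge0// sqr_ge0.
    by apply/measurable_EFinP; exact: measurable_funM.
rewrite -(fubini_tonelli G)// -ge0_integralZl_EFin//; last 2 first.
- by move=> t _; rewrite lee_fin sqr_ge0.
- exact/measurable_EFinP.
have mGF := @measurable_fun_fubini_tonelli_F _ _ _ _ _ m2 G mG G0.
apply: ge0_le_integral => //.
- by move=> t _; apply: integral_ge0 => s _; exact: (G0 (t, s)).
- by apply/measurable_EFinP; exact: measurable_funM.
move=> t _; rewrite /G/=.
under eq_integral => s _ do rewrite mulrA mulrC EFinM.
rewrite ge0_integralZl_EFin ?sqr_ge0//; last 2 first.
- by move=> s _; rewrite lee_fin mulr_ge0.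
- by apply/measurable_EFinP; exact: measurable_funM.
by rewrite muleC lee_wpmul2r// lee_fin sqr_ge0.
Qed.

End schur_test.

(** * Square-integrable functions and operator norms *)

Section integral_sections.
Local Open Scope ereal_scope.
Context d1 d2 (X : measurableType d1) (Y : measurableType d2) (R : realType).
Context (m1 : {sigma_finite_measure set X -> \bar R}).

Lemma measurable_fun_integral_section (H : X * Y -> \bar R) :
  measurable_fun setT H -> measurable_fun setT (fun y => \int[m1]_x H (x, y)).
Proof.
move=> mH.
have mHp : measurable_fun setT H^\+ by exact: measurable_funepos.
have mHn : measurable_fun setT H^\- by exact: measurable_funeneg.
rewrite (_ : (fun _ => _) =
    fun y => \int[m1]_x H^\+ (x, y) - \int[m1]_x H^\- (x, y)); last first.
  apply/funext => y; rewrite integralE; congr (_ - _); apply: eq_integral => x _.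
    by rewrite !funeposE.
  by rewrite !funenegE.
apply: emeasurable_funB.
- exact: (@measurable_fun_fubini_tonelli_G _ _ _ _ _ m1 _ mHp (funepos_ge0 H)).
- exact: (@measurable_fun_fubini_tonelli_G _ _ _ _ _ m1 _ mHn (funeneg_ge0 H)).
Qed.

End integral_sections.

Section square_integrable.
Context {R : realType}.
Local Notation mu := (@lebesgue_measure R).
Implicit Types (D : set R) (f g : R -> R) (A : (R -> R) -> R -> R) (c : R).

Lemma L2P D f : L2 D f <->
  measurable_fun setT (f \_ D) /\ (L2norm D f < +oo)%E.
Proof.
rewrite /L2; split=> [/andP[]|[mf fy]]; last by apply/andP; split; rewrite inE.
by rewrite !inE.
Qed.

Lemma L2norm_sqr D f :
  (L2norm D f ^+ 2 = \int[mu]_x ((f \_ D) x ^+ 2)%:E)%E.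
Proof. exact: Lnorm2_sqr. Qed.

Lemma L2_lty_sqr D f :
  (L2norm D f < +oo)%E = (\int[mu]_x ((f \_ D) x ^+ 2)%:E < +oo)%E.
Proof.
rewrite -L2norm_sqr; have : (0 <= L2norm D f)%E by exact: Lnorm_ge0.
by case: (L2norm D f) => // r _; rewrite -EFin_expe !ltry.
Qed.

Lemma L2_opnorm_sqr_le D A c : 0 <= c ->
  (forall f, L2 D f -> (\int[mu]_x ((A f \_ D) x ^+ 2)%:E <=
     c%:E * \int[mu]_x ((f \_ D) x ^+ 2)%:E)%E) ->
  (L2_opnorm D A < +oo)%E /\ (L2_opnorm D A ^+ 2 <= c%:E)%E.
Proof.
move=> c0 Ac.
have sqrt_c : ((Num.sqrt c)%:E ^+ 2 = c%:E)%E by rewrite -EFin_expe sqr_sqrtr.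
have le_sqrt : (L2_opnorm D A <= (Num.sqrt c)%:E)%E.
  apply: ge_ereal_sup => _ [f [L2f f1] <-].
  apply: lee_sqrE; first by rewrite lee_fin sqrtr_ge0.
  rewrite L2norm_sqr sqrt_c (le_trans (Ac f L2f))// -L2norm_sqr.
  rewrite -[leRHS]mule1 lee_wpmul2l//.
  by rewrite -[leRHS](mule1 1%E) -expe2 lee_sqr// Lnorm_ge0.
have L20 : L2norm D (fun=> 0) = 0%E.
  rewrite /L2norm (_ : EFin \o _ = cst 0%E) ?Lnorm0//.
  by apply/funext => x /=; rewrite /patch; case: ifP.
(* The supremum of an empty set would be -oo, whose square is +oo; the zero
   function shows that the set of norms is nonempty. *)
have ge0 : (0 <= L2_opnorm D A)%E.
  apply: (@le_trans _ _ (L2norm D (A (fun=> 0)))); first exact: Lnorm_ge0.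
  apply: ereal_sup_ubound; exists (fun=> 0) => //; split; last by rewrite L20.
  apply/L2P; rewrite L20; split=> //.
  rewrite (_ : _ \_ _ = cst 0); first exact: measurable_cst.
  by apply/funext => x; rewrite /patch; case: ifP.
split; first exact: le_lt_trans le_sqrt (ltry _).
by rewrite -sqrt_c lee_sqr// lee_fin sqrtr_ge0.
Qed.

End square_integrable.

(** * Regularity of the kernel *)

Section kernel.
Context {R : realType}.
Local Notation mu := (@lebesgue_measure R).
Implicit Types (T s t : R) (K : R -> R -> R).

Definition open_triangle T : set (R * R) :=
  [set x | 0 < x.2 /\ x.2 < x.1 /\ x.1 < T].

Lemma measurable_preimage_itv (g : R * R -> R) (i : interval R) :
  measurable_fun setT g -> measurable (g @^-1` [set` i]).
Proof.
by move=> mg; rewrite -[X in measurable X]setTI; apply: mg => //; exact: measurable_itv.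
Qed.

Lemma measurable_triangle T : measurable (triangle T).
Proof.
rewrite (_ : triangle T = snd @^-1` `[0, +oo[ `&`
    ((fun x : R * R => x.1 - x.2) @^-1` `[0, +oo[ `&` fst @^-1` `]-oo, T])).
  apply: measurableI; first exact: measurable_preimage_itv measurable_snd.
  apply: measurableI; last exact: measurable_preimage_itv measurable_fst.
  exact: measurable_preimage_itv (measurable_funB measurable_fst measurable_snd).
by apply/seteqP; split=> x /=; rewrite !in_itv/= !andbT subr_ge0.
Qed.

Lemma measurable_open_triangle T : measurable (open_triangle T).
Proof.
rewrite (_ : open_triangle T = snd @^-1` `]0, +oo[ `&`
    ((fun x : R * R => x.1 - x.2) @^-1` `]0, +oo[ `&` fst @^-1` `]-oo, T[)).
  apply: measurableI; first exact: measurable_preimage_itv measurable_snd.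
  apply: measurableI; last exact: measurable_preimage_itv measurable_fst.
  exact: measurable_preimage_itv (measurable_funB measurable_fst measurable_snd).
by apply/seteqP; split=> x /=; rewrite !in_itv/= !andbT subr_gt0.
Qed.

Section continuous_kernel.
Context (T : R) (K : R -> R -> R).
Hypothesis cK : {within triangle T, continuous (fun x : R * R => K x.1 x.2)}.

Lemma measurable_fun_kernel_comp d (X : measurableType d) (E : set X) (p q : X -> R) :
  measurable_fun setT p -> measurable_fun setT q ->
  (forall x, E x -> 0 <= q x /\ q x <= p x /\ p x <= T) ->
  measurable_fun E (fun x => K (p x) (q x)).
Proof.
move=> mp mq pqT.
have mK := continuous_measurable_fun_prod (measurable_triangle T) cK.
have mpq : measurable_fun E (fun x => (p x, q x)).
  exact/measurable_funTS/measurable_fun_pair.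
apply: (measurable_comp (measurable_triangle T) _ mK mpq).
by move=> _ [x Ex <-]; exact: pqT.
Qed.

Lemma kernel_section_continuous s : 0 <= s -> {within `[s, T], continuous (K ^~ s)}.
Proof.
move=> s0; apply/subspace_continuousP => t /=; rewrite in_itv/= => /andP[st tT].
have Kts := (subspace_continuousP _ _).1 cK (t, s) (conj s0 (conj st tT)).
apply: (cvg_comp (fun u => (u, s)) (fun x : R * R => K x.1 x.2) _ Kts).
have ts : (u, s) @[u --> t] --> (t, s).
  exact: (cvg_pair (@cvg_id _ (nbhs t)) (@cvg_cst R s _ (nbhs t) _)).
move=> U tsU; have {}tsU : nbhs (t, s) [set x | triangle T x -> U x] by exact: tsU.
suff : nbhs t [set u | u \in `[s, T] -> U (u, s)] by [].
have {}ts : nbhs t [set u | triangle T (u, s) -> U (u, s)] by exact: ts _ tsU.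
apply: filterS ts => u /= uU; rewrite in_itv/= => /andP[su uT].
exact: uU.
Qed.

Hypothesis dKT : forall s t, 0 < s -> s < t -> t < T -> derivable (K ^~ s) t 1.

(** The derivative is the pointwise limit of difference quotients.  Truncating
    the shifted time at $T$ keeps both arguments in the closed triangle, where
    $K$ is continuous, and changes nothing for small shifts. *)
Lemma measurable_fun_dK :
  measurable_fun (open_triangle T) (fun x : R * R => dK K x.1 x.2).
Proof.
pose D n (x : R * R) := n.+1%:R * (K (Num.min (x.1 + n.+1%:R^-1) T) x.2 - K x.1 x.2).
apply: (@measurable_fun_cvg _ _ _ _ D) => [n|[t s] /= [s0 [st tT]]].
  apply: measurable_funM; first exact: measurable_cst.
  have m1 : measurable_fun setT (fst : R * R -> R) by exact: measurable_fst.
  have m2 : measurable_fun setT (snd : R * R -> R) by exact: measurable_snd.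
  apply: measurable_funB; last first.
    apply: measurable_fun_kernel_comp => // x [s0 [st tT]].
    by rewrite !ltW.
  apply: measurable_fun_kernel_comp => //.
    apply: measurable_minr; last exact: measurable_cst.
    by apply: measurable_funD => //; exact: measurable_cst.
  move=> x [s0 [st tT]]; split; first exact: ltW.
  rewrite ge_min lexx orbT; split=> //.
  by rewrite le_min (ltW (lt_trans st tT)) andbT (le_trans (ltW st))// lerDl.
apply: cvg_trans (derive1_harmonic_cvg (dKT s0 st tT)).
have tT0 : 0 < T - t by rewrite subr_gt0.
apply: near_eq_cvg; near=> n; rewrite /D /=.
rewrite (min_idPl _)// -lerBrDl ltW//; near: n.
exact: (cvgr_lt _ (@cvg_harmonic R) _ tT0).
Unshelve. all: by end_near. Qed.

End continuous_kernel.
End kernel.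

(** * The integral operator *)

Section kernel_operator.
Context {R : realType}.
Local Notation mu := (@lebesgue_measure R).
Implicit Types (s t : R) (f g h : R -> R).

(** Extension by zero turns the integrals over $(s,T)$ and over $(0,t)$ into
    sections of one function on the plane, as Tonelli's theorem requires. *)
Definition density (T : R) (K : R -> R -> R) : R * R -> R :=
  (fun x : R * R => dK K x.1 x.2) \_ (open_triangle T).

Definition integral_part T K f s : R :=
  \int[mu]_t (density T K (t, s) * (f \_ `]0, T[) t).

(** Extended-real valued, so that it can be estimated before it is known to be
    finite for almost every $s$. *)
Definition abs_integral_part T K f s : \bar R :=
  (\int[mu]_t (density T K (t, s) * `|(f \_ `]0%R, T[) t|)%:E)%E.

Context (T : R) (K : R -> R -> R) (K_0 K_1 : R).
Hypothesis T0 : 0 < T.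
Hypothesis cK : {within triangle T, continuous (fun x : R * R => K x.1 x.2)}.
Hypothesis K_ge0 : forall s t, 0 <= s -> s <= t -> t <= T -> 0 <= K t s.
Hypothesis K_diag : forall t, t \in `]0, T[ -> K t t <= K_0.
Hypothesis dKT : forall s t, 0 < s -> s < t -> t < T ->
  derivable (K ^~ s) t 1 /\ 0 <= dK K t s.
Hypothesis K_weight : forall t, t \in `]0, T[ ->
  (\int[mu]_(s in `]0%R, t[) (K T s * dK K t s)%:E <= K_1%:E)%E.

Local Notation D := (`]0, T[%classic : set R).
Local Notation k := (density T K).

Let w := (K T) \_ D.

Lemma density_ge0 z : 0 <= k z.
Proof.
rewrite /density /patch; case: ifPn => //; rewrite inE => -[z0 [z21 z1T]].
by have [] := dKT z0 z21 z1T.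
Qed.

Lemma measurable_density : measurable_fun setT k.
Proof.
apply/(measurable_restrictT _ (measurable_open_triangle T)).
by apply: measurable_fun_dK => // s t s0 st tT; have [] := dKT s0 st tT.
Qed.

Lemma density_section s h : s \in `]0, T[ ->
  (fun t => k (t, s) * h t) = (fun t => dK K t s * h t) \_ `]s, T[.
Proof.
rewrite in_itv/= => /andP[s0 sT]; apply/funext => t; rewrite /density /patch.
case: ifPn => [/set_mem/= [_ [st tT]]|/negP ntri].
  by rewrite mem_set//= in_itv/= st.
rewrite mul0r; case: ifPn => //; rewrite inE/= in_itv/= => /andP[st tT].
by case: ntri; apply: mem_set.
Qed.

Lemma density_cosection t h : t \in `]0, T[ ->
  (fun s => h s * k (t, s)) = (fun s => h s * dK K t s) \_ `]0, t[.
Proof.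
rewrite in_itv/= => /andP[t0 tT]; apply/funext => s; rewrite /density /patch.
case: ifPn => [/set_mem/= [s0 [st _]]|/negP ntri].
  by rewrite mem_set//= in_itv/= s0.
rewrite mulr0; case: ifPn => //; rewrite inE/= in_itv/= => /andP[s0 st].
by case: ntri; apply: mem_set.
Qed.

Lemma density_out t s : (t, s) \notin open_triangle T -> k (t, s) = 0.
Proof. by rewrite /density /patch => /negbTE ->. Qed.

Lemma measurable_weight : measurable_fun setT w.
Proof.
apply/(measurable_restrictT _ (measurable_itv `]0, T[)).
apply: (measurable_fun_kernel_comp cK) => //.
by move=> s; rewrite /= in_itv/= => /andP[/ltW s0 /ltW sT].
Qed.

Lemma weight_ge0 s : 0 <= w s.
Proof.
rewrite /w /patch; case: ifPn => //; rewrite inE/= in_itv/= => /andP[/ltW s0 /ltW sT].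
exact: K_ge0.
Qed.

(** The increment of $K(\cdot,s)$ over $[s,T]$ is at most $K(T,s)$ because
    $K(s,s)\ge0$. *)
Lemma integral_dK_le s : s \in `]0, T[ ->
  measurable_fun `]s, T[ (dK K ^~ s) /\
  (\int[mu]_(t in `]s, T[) (dK K t s)%:E <= (K T s)%:E)%E.
Proof.
rewrite in_itv/= => /andP[s0 sT].
have [||mdK] := integral_derive1_le sT (kernel_section_continuous cK (ltW s0)).
- by move=> t; rewrite in_itv/= => /andP[st tT]; have [] := dKT s0 st tT.
- by move=> t; rewrite in_itv/= => /andP[st tT]; have [] := dKT s0 st tT.
move=> le_dK; split=> //; apply: (le_trans le_dK).
by rewrite lee_fin lerBlDr lerDl K_ge0// ltW.
Qed.

Lemma integral_density_le s : (\int[mu]_t (k (t, s))%:E <= (w s)%:E)%E.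
Proof.
have [sT|sT] := boolP (s \in `]0, T[).
  under eq_integral => t _ do rewrite -[k (t, s)]mulr1.
  rewrite (_ : (fun t => _) = EFin \o (fun t => k (t, s) * 1))//.
  rewrite (density_section (fun=> 1) sT) -restrict_EFin -integral_mkcond.
  rewrite /w /patch mem_set//.
  have [_] := integral_dK_le sT; apply: le_trans.
  by under eq_integral do rewrite /= mulr1.
rewrite integral0_eq ?lee_fin ?weight_ge0// => t _.
rewrite density_out//; apply: contra sT; rewrite inE/= => -[s0 [st tT]].
by rewrite in_itv/= s0 (lt_trans st tT).
Qed.

Lemma K_1_ge0 : 0 <= K_1.
Proof.
have T2T : T / 2 < T by have := T0; lra.
have T2 : T / 2 \in `]0, T[ by rewrite in_itv/= T2T divr_gt0.
rewrite -lee_fin; apply: le_trans (K_weight T2); apply: integral_ge0 => s.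
rewrite /= in_itv/= => /andP[s0 sT2]; have sT := lt_trans sT2 T2T.
by rewrite lee_fin mulr_ge0 ?K_ge0 ?(ltW s0) ?(ltW sT)//; have [] := dKT s0 sT2 T2T.
Qed.

Lemma integral_weight_density_le t :
  (\int[mu]_s (w s * k (t, s))%:E <= K_1%:E)%E.
Proof.
have [tT|tT] := boolP (t \in `]0, T[); last first.
  rewrite integral0_eq ?lee_fin ?K_1_ge0// => s _.
  rewrite density_out ?mulr0//; apply: contra tT; rewrite inE/= => -[s0 [st tT]].
  by rewrite in_itv/= tT (lt_trans s0 st).
rewrite (_ : (fun s => _) = EFin \o (fun s => w s * k (t, s)))//.
rewrite (density_cosection w tT) -restrict_EFin -integral_mkcond.
apply: le_trans (K_weight tT).
rewrite le_eqVlt; apply/orP; left; apply/eqP/eq_integral => s.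
rewrite inE/= in_itv/= => /andP[s0 st]; congr (_ * _)%:E.
by rewrite /w /patch mem_set//= in_itv/= s0 (lt_trans st)// (itvP tT).
Qed.


Lemma Kstar_formula_density f s : s \in `]0, T[ ->
  Kstar_formula T K f s = K s s * (f \_ D) s + integral_part T K f s.
Proof.
move=> sT; rewrite /Kstar_formula /integral_part Rintegral_mkcond.
rewrite -(density_section f sT); congr (_ + _).
  by rewrite /patch mem_set.
apply: eq_Rintegral => t _; rewrite /patch; case: ifPn => // /negP tD.
rewrite density_out ?mul0r//; apply/negP => /set_mem[/= s0 [st tT]].
by apply: tD; apply: mem_set; rewrite /= in_itv/= (lt_trans s0 st).
Qed.

Section fixed_function.
Context (f : R -> R).
Hypothesis mf : measurable_fun setT (f \_ D).

Local Notation F := (abs_integral_part T K f).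

Lemma measurable_density_mul :
  measurable_fun setT (fun x : R * R => k x * (f \_ D) x.1).
Proof.
apply: measurable_funM; first exact: measurable_density.
exact: measurableT_comp mf measurable_fst.
Qed.

Lemma measurable_density_section s :
  measurable_fun setT (fun t => k (t, s) * (f \_ D) t).
Proof. exact: measurableT_comp measurable_density_mul (pair2_measurable s). Qed.

Lemma abs_integral_part_ge0 s : (0 <= F s)%E.
Proof.
by apply: integral_ge0 => t _; rewrite lee_fin mulr_ge0// density_ge0.
Qed.

Lemma abs_integral_partE s :
  F s = (\int[mu]_t `|(k (t, s) * (f \_ D) t)%:E|)%E.
Proof.
apply: eq_integral => t _ /=.
by rewrite normrM (ger0_norm (density_ge0 _)).
Qed.

Lemma measurable_abs_integral_part : measurable_fun setT F.
Proof.
rewrite (_ : F = fun s => \int[mu]_t `|(k (t, s) * (f \_ D) t)%:E|)%E; last first.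
  by apply/funext => s; exact: abs_integral_partE.
apply: (@measurable_fun_integral_section _ _ _ _ _ mu
  (fun x : R * R => `|(k x * (f \_ D) x.1)%:E|%E)).
apply: measurableT_comp => //; apply/measurable_EFinP; exact: measurable_density_mul.
Qed.

Lemma measurable_integral_part : measurable_fun setT (integral_part T K f).
Proof.
rewrite /integral_part /Rintegral; apply: measurableT_comp; first exact: fine_measurable.
apply: (@measurable_fun_integral_section _ _ _ _ _ mu
  (fun x : R * R => (k x * (f \_ D) x.1)%:E)).
by apply/measurable_EFinP; exact: measurable_density_mul.
Qed.

Lemma integral_part_le s : (`|integral_part T K f s|%:E <= F s)%E.
Proof.
rewrite abs_integral_partE; apply: le_trans (le_abse_integral _ _ _) => //; last first.
  by apply/measurable_EFinP; exact: measurable_density_section.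
rewrite /integral_part /Rintegral.
by case: (\int[mu]_t (k (t, s) * (f \_ D) t)%:E)%E => //= *; rewrite normr0 leey.
Qed.

Lemma abs_integral_part_sqr_le :
  (\int[mu]_s F s ^+ 2 <= K_1%:E * \int[mu]_t ((f \_ D) t ^+ 2)%:E)%E.
Proof.
apply: (@schur_test _ _ _ _ _ mu mu k w).
- exact: measurable_density.
- exact: measurable_weight.
- exact: mf.
- exact: density_ge0.
- exact: weight_ge0.
- exact: K_1_ge0.
- exact: integral_density_le.
- exact: integral_weight_density_le.
Qed.

Lemma measurable_abs_integral_part_sqr : measurable_fun setT (fun s => (F s ^+ 2)%E).
Proof.
under eq_fun do rewrite expe2.
by apply: emeasurable_funM; exact: measurable_abs_integral_part.
Qed.

Lemma measurable_Kstar_formula : measurable_fun setT (Kstar_formula T K f \_ D).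
Proof.
apply/(measurable_restrictT _ (measurable_itv `]0, T[)).
apply: (@eq_measurable_fun _ _ _ _ _ (fun s => K s s * (f \_ D) s + integral_part T K f s)).
  by move=> s; rewrite inE => sD; rewrite Kstar_formula_density.
apply: measurable_funD; last exact: measurable_funTS measurable_integral_part.
apply: measurable_funM; last exact: measurable_funTS mf.
apply: (measurable_fun_kernel_comp cK) => // s.
by rewrite /= in_itv/= => /andP[/ltW s0 /ltW sT].
Qed.

Lemma K_diag_ge0 s : s \in `]0, T[ -> 0 <= K s s.
Proof. by rewrite in_itv/= => /andP[/ltW s0 /ltW sT]; exact: K_ge0. Qed.

Lemma Kstar_formula_sqr_le :
  (\int[mu]_s ((Kstar_formula T K f \_ D) s ^+ 2)%:E <=
   (2 * (K_0 ^+ 2 + K_1))%:E * \int[mu]_t ((f \_ D) t ^+ 2)%:E)%E.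
Proof.
have mf2 : measurable_fun setT (fun t => (((f \_ D) t) ^+ 2)%:E).
  by apply/measurable_EFinP; exact: measurable_funX.
have mF2 := measurable_abs_integral_part_sqr.
have c0 : 0 <= 2 * K_0 ^+ 2 by rewrite mulr_ge0// sqr_ge0.
apply: (@le_trans _ _ (\int[mu]_s ((2 * K_0 ^+ 2)%:E * ((f \_ D) s ^+ 2)%:E +
    2%:E * F s ^+ 2))%E).
  apply: ge0_le_integral => //.
  - by move=> s _; rewrite lee_fin sqr_ge0.
  - by apply/measurable_EFinP; apply: measurable_funX; exact: measurable_Kstar_formula.
  - by apply: emeasurable_funD; apply: measurable_funeM.
  move=> s _; have := integral_part_le s; have := abs_integral_part_ge0 s.
  rewrite {1}/patch; case: ifPn => [|_]; last first.
    move=> F0 _; rewrite expr0n/= adde_ge0// mule_ge0 ?lee_fin ?sqr_ge0//.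
    exact: sqre_ge0.
  rewrite inE => sD; rewrite Kstar_formula_density//.
  case: (F s) => [r|_ _|]//; last by rewrite expe2 mulyy gt0_muley ?addey ?leey ?lte_fin.
  rewrite -EFin_expe !lee_fin => r0 Br.
  set a := (f \_ D) s; set B := integral_part T K f s in Br *.
  have Ba : (K s s * a) ^+ 2 <= K_0 ^+ 2 * a ^+ 2.
    by rewrite exprMn ler_wpM2r ?sqr_ge0// lerXn2r ?nnegrE ?K_diag ?K_diag_ge0//
      (le_trans (K_diag_ge0 sD))// K_diag.
  have B2 : B ^+ 2 <= r ^+ 2 by rewrite -(real_normK (num_real B)) lerXn2r ?nnegrE.
  (* (a + b)^2 <= 2 a^2 + 2 b^2, from the square of the difference *)
  by have := sqr_ge0 (K s s * a - B); rewrite sqrrB sqrrD; lra.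
rewrite ge0_integralD//; last first.
- exact: measurable_funeM.
- by move=> s _; rewrite mule_ge0 ?sqre_ge0.
- exact: measurable_funeM.
- by move=> s _; rewrite mule_ge0 ?lee_fin ?sqr_ge0.
rewrite !ge0_integralZl_EFin//; last 2 first.
- by move=> s _; exact: sqre_ge0.
- by move=> s _; rewrite lee_fin sqr_ge0.
have E0 : (0 <= \int[mu]_t ((f \_ D) t ^+ 2)%:E)%E.
  by apply: integral_ge0 => t _; rewrite lee_fin sqr_ge0.
have -> : (2 * (K_0 ^+ 2 + K_1))%:E = ((2 * K_0 ^+ 2)%:E + (2 * K_1)%:E)%E.
  by rewrite -EFinD mulrDr.
rewrite [leRHS]ge0_muleDl ?lee_fin ?(mulr_ge0 _ K_1_ge0)//.
apply: leeD => //.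
by rewrite EFinM -muleA lee_wpmul2l// abs_integral_part_sqr_le.
Qed.

Lemma Kstar_formula_sqr_le0 : K_0 = 0 ->
  (\int[mu]_s ((Kstar_formula T K f \_ D) s ^+ 2)%:E <=
   K_1%:E * \int[mu]_t ((f \_ D) t ^+ 2)%:E)%E.
Proof.
move=> K00; apply: le_trans abs_integral_part_sqr_le; apply: ge0_le_integral => //.
- by move=> s _; rewrite lee_fin sqr_ge0.
- by apply/measurable_EFinP; apply: measurable_funX; exact: measurable_Kstar_formula.
- exact: measurable_abs_integral_part_sqr.
move=> s _; rewrite {1}/patch; case: ifPn => [|_]; last by rewrite expr0n/= sqre_ge0.
rewrite inE => sD; rewrite Kstar_formula_density//.
have -> : K s s = 0 by apply/eqP; rewrite eq_le K_diag_ge0// -K00 K_diag.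
rewrite mul0r add0r -(real_normK (num_real _)) EFin_expe lee_sqr ?lee_fin//.
  exact: integral_part_le.
exact: abs_integral_part_ge0.
Qed.

End fixed_function.

Lemma Kstar_formula_L2 f : L2 D f -> L2 D (Kstar_formula T K f).
Proof.
move=> /L2P[mf fy]; apply/L2P; split; first exact: measurable_Kstar_formula.
rewrite L2_lty_sqr (le_lt_trans (Kstar_formula_sqr_le mf))//.
rewrite -L2norm_sqr lte_mul_pinfty ?lee_fin//.
  by rewrite mulr_ge0// addr_ge0 ?sqr_ge0 ?K_1_ge0.
by rewrite L2norm_sqr -L2_lty_sqr.
Qed.

(** The square of the integral with absolute values is integrable, hence finite
    almost everywhere; where it is finite the operator is additive in $f$. *)
Lemma ae_integrable_density f : L2 D f ->
  {ae mu, forall s, mu.-integrable setT (EFin \o (fun t => k (t, s) * (f \_ D) t))}.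
Proof.
move=> /L2P[mf fy].
have iF : mu.-integrable setT (fun s => (abs_integral_part T K f s ^+ 2)%E).
  apply/integrableP; split; first exact: measurable_abs_integral_part_sqr.
  under eq_integral do rewrite gee0_abs ?sqre_ge0//.
  apply: (le_lt_trans (abs_integral_part_sqr_le mf)).
  rewrite lte_mul_pinfty ?lee_fin ?K_1_ge0//.
  by rewrite -L2_lty_sqr.
apply: filterS (integrable_ae measurableT iF) => s /(_ I) Fs.
apply/integrableP; split.
  by apply/measurable_EFinP; exact: measurable_density_section.
rewrite -abs_integral_partE; have := abs_integral_part_ge0 f s.
by move: Fs; case: (abs_integral_part T K f s) => //= r _ _; exact: ltry.
Qed.

Lemma integral_part_linear c f g s :
  mu.-integrable setT (EFin \o (fun t => k (t, s) * (f \_ D) t)) ->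
  mu.-integrable setT (EFin \o (fun t => k (t, s) * (g \_ D) t)) ->
  integral_part T K (fun x => c * f x + g x) s =
  c * integral_part T K f s + integral_part T K g s.
Proof.
move=> If Ig; rewrite /integral_part -RintegralZl// -RintegralD//; last first.
  by apply: eq_integrable (integrableZl measurableT c If).
apply: eq_Rintegral => t _.
by rewrite /patch; case: ifP => _; rewrite ?mulr0 ?addr0// mulrDr mulrCA.
Qed.

Lemma Kstar_formula_operator : L2_operator D (Kstar_formula T K).
Proof.
split=> [f|f g L2f L2g fg|c f g L2f L2g]; first exact: Kstar_formula_L2.
  have [mf _] := (L2P _ _).1 L2f; have [mg _] := (L2P _ _).1 L2g.
  have fgD : ae_eq mu setT (f \_ D) (g \_ D).
    apply: filterS fg => t fgt _; rewrite /patch; case: ifPn => //.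
    by rewrite inE => /fgt.
  have If s : integral_part T K f s = integral_part T K g s.
    rewrite /integral_part /Rintegral; congr fine; apply: ae_eq_integral => //.
    - by apply/measurable_EFinP; exact: measurable_density_section.
    - by apply/measurable_EFinP; exact: measurable_density_section.
    - by apply: filterS fgD => t /(_ I) /= ->.
  apply: filterS fg => s fgs sD.
  by rewrite !Kstar_formula_density// If /patch mem_set// fgs.
have FF : Filter (almost_everywhere mu) by exact: ae_filter_ringOfSetsType.
apply: (@filterS2 _ _ FF _ _ _ _ (ae_integrable_density L2f) (ae_integrable_density L2g)).
move=> s If Ig sD.
rewrite !Kstar_formula_density// integral_part_linear// /patch mem_set//.
by ring.
Qed.

Lemma test_function_bounded (phi : R -> R) : test_function T phi ->
  measurable_fun setT phi /\ exists M : R, forall x, `|phi x| <= M.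
Proof.
move=> [dphi [a [b [a0 bT phi0]]]].
have cphi : continuous phi.
  by move=> x; apply/differentiable_continuous/derivable1_diffP; exact: (dphi 0%N).
split; first exact: continuous_measurable_fun.
have [ab|ba] := leP a b; last first.
  exists 0 => x; rewrite phi0 ?normr0// in_itv/=; apply/negP => /andP[ax xb].
  by have := le_trans ax xb; rewrite leNgt ba.
have [m [M phiM]] := segment_bounded_on ab (continuous_subspaceT cphi).
exists (`|m| + `|M|) => x.
have [xab|xab] := boolP (x \in `[a, b]); last by rewrite phi0 ?normr0 ?addr_ge0.
move: xab; rewrite in_itv/= => /andP[ax xb]; have /andP[mx xM] := phiM x ax xb.
rewrite ler_norml; have := ler_norm M; have := ler_norm (- m).
by rewrite normrN; have := normr_ge0 m; have := normr_ge0 M; lra.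
Qed.

Lemma integrable_dK_test (phi : R -> R) s : test_function T phi -> s \in `]0, T[ ->
  mu.-integrable `]s, T[ (fun t => (dK K t s * phi t)%:E).
Proof.
move=> /test_function_bounded[mphi [M phiM]] sD.
have [mdK le_dK] := integral_dK_le sD.
have dK0 t : t \in `]s, T[ -> 0 <= dK K t s.
  move: sD; rewrite !in_itv/= => /andP[s0 _] /andP[st tT].
  by have [] := dKT s0 st tT.
have idK : mu.-integrable `]s, T[ (fun t => (dK K t s)%:E).
  apply/integrableP; split; first exact/measurable_EFinP.
  apply: le_lt_trans (le_lt_trans le_dK (ltry _)).
  rewrite le_eqVlt; apply/orP; left; apply/eqP/eq_integral => t.
  by rewrite inE => tD /=; rewrite ger0_norm// dK0.
apply: (@le_integrable _ _ _ mu _ _ _ (fun t => (M%:E * (dK K t s)%:E)%E)) => //.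
- apply/measurable_EFinP; apply: measurable_funM => //; exact: measurable_funTS.
- move=> t tD; rewrite -EFinM !abse_EFin lee_fin !normrM mulrC ler_wpM2r//.
  exact: le_trans (phiM t) (ler_norm M).
- exact: integrableZl.
Qed.

End kernel_operator.

(** * The theorem *)

Theorem theorem7 (R : realType) (d : measure_display) (Omega : measurableType d)
    (P : probability Omega R) (W X : R -> {RV P >-> R}) (T : R)
    (K : R -> R -> R) (Kstar : (R -> R) -> R -> R)
    (hT : 0 < T)
    (hW : brownian_motion W)
    (hK2 : forall t : R, t \in `[0, T] -> L2 `[0, T] (K t))
    (hX : forall t : R, t \in `[0, T] -> is_wiener_integral W T (K t) (X t))
    (hna : non_anticipating W T X)
    (hKvan : forall t s : R, t \in `[0, T] -> s \in `[0, T] -> t < s -> K t s = 0)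
    (hKstar : corresponding_operator T K Kstar) :
  (* (a) *)
  (forall (N : nat) (p a : nat -> R),
    (forall k, (k <= N)%N -> p k \in `[0, T]) ->
    (forall k, (k < N)%N -> p k < p k.+1) ->
    forall s : R, s \in `[0, T] -> p 0%N < s ->
      Kstar (stepfun p a N) s =
      \sum_(i < N) (chi (p i.+1) s - chi (p i) s) *
        (a i * K (p i.+1) s +
         \sum_(i.+1 <= k < N) a k * (K (p k.+1) s - K (p k) s))) /\
  (* (b) *)
  ((forall s : R, s \in `[0, T] -> bounded_variation 0 T (K ^~ s)) ->
   (forall s : R, s \in `]0, T[ -> cvg (K ^~ s @ s^'+)) ->
   forall f : R -> R, {within `[0, T], continuous f} ->
   forall s : R, s \in `]0, T[ ->
   exists2 J : R, is_RS_integral_right f (K ^~ s) s T J &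
     is_Kstar_limit T Kstar f s (lim (K ^~ s @ s^'+) * f s + J)) /\
  (* (c) *)
  (forall K_0 K_1 : R,
    {within triangle T, continuous (fun x : R * R => K x.1 x.2)} ->
    (forall s t : R, 0 <= s -> s <= t -> t <= T -> 0 <= K t s) ->
    (ereal_sup [set (K t t)%:E | t in `]0%R, T[] <= K_0%:E)%E ->
    (forall s t : R, 0 < s -> s < t -> t < T ->
      derivable (K ^~ s) t 1 /\ 0 <= dK K t s) ->
    (ereal_sup [set \int[lebesgue_measure]_(s in `]0%R, t[)
                      (K T s * dK K t s)%:E
               | t in `]0%R, T[] <= K_1%:E)%E ->
    exists A : (R -> R) -> R -> R,
    [/\ L2_operator `]0, T[ A,
        forall phi, test_function T phi ->
          (forall s : R, s \in `]0, T[ ->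
            (@lebesgue_measure R).-integrable `]s, T[%classic
              (fun t => (dK K t s * phi t)%:E)) /\
          ae_eq (@lebesgue_measure R) `]0, T[%classic (A phi) (Kstar_formula T K phi),
        (L2_opnorm `]0%R, T[ A < +oo)%E,
        0 < K_0 ->
          (L2_opnorm `]0%R, T[ A ^+ 2 <= (2 * (K_0 ^+ 2 + K_1))%:E)%E &
        K_0 = 0 -> (L2_opnorm `]0%R, T[ A ^+ 2 <= K_1%:E)%E]).
Proof.
split; [|split].
- move=> N p a pT pinc s sT p0s; rewrite (corresponding_operator_stepfun hKstar)//.
  exact: stepfun_abel_sum hKvan pT pinc sT p0s.
- move=> BVK cvK f cf s sT.
  have sT' : s \in `[0, T] by move: sT; rewrite !in_itv/= => /andP[/ltW -> /ltW ->].
  apply: corresponding_operator_continuous => //.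
  + by move=> t tT; exact: hKvan.
  + exact: BVK.
  + exact: cvK.
move=> K_0 K_1 cK K_ge0 hK0 dKT hK1.
have K_diag t : t \in `]0, T[ -> K t t <= K_0.
  move=> tT; rewrite -lee_fin; apply: le_trans hK0.
  by apply: ereal_sup_ubound; exists t.
have K_weight t : t \in `]0, T[ ->
    (\int[lebesgue_measure]_(s in `]0%R, t[) (K T s * dK K t s)%:E <= K_1%:E)%E.
  by move=> tT; apply: le_trans hK1; apply: ereal_sup_ubound; exists t.
have K1_ge0 := K_1_ge0 hT K_ge0 dKT K_weight.
have c_ge0 : 0 <= 2 * (K_0 ^+ 2 + K_1) by rewrite mulr_ge0// addr_ge0// sqr_ge0.
have bound := L2_opnorm_sqr_le c_ge0 (fun f L2f =>
  Kstar_formula_sqr_le hT cK K_ge0 K_diag dKT K_weight (proj1 ((L2P _ _).1 L2f))).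
exists (Kstar_formula T K); split.
- exact: Kstar_formula_operator cK K_ge0 K_diag dKT K_weight.
- move=> phi tphi; split; first by move=> s sT; exact: integrable_dK_test.
  exact: ae_eq_refl.
- exact: bound.1.
- by move=> _; exact: bound.2.
- move=> K00; exact: (L2_opnorm_sqr_le K1_ge0 (fun f L2f =>
    Kstar_formula_sqr_le0 hT cK K_ge0 K_diag dKT K_weight (proj1 ((L2P _ _).1 L2f)) K00)).2.
Qed.
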